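(* Let $(R,V,W,S)$ be a Morita context and consider the following conditions. (1) $(R,V,W,S)$ is a prime ring. (2) $R$ and $S$ are prime rings and ${}_RV_S$, ${}_SW_R$ are prime modules. (3) $R$ and $S$ are prime rings. (4) $R$ or $S$ is a prime ring. Then (1) $\Rightarrow$ (2) $\Rightarrow$ (3) $\Rightarrow$ (4). If moreover $VW=R$ and $WV=S$, then (4) $\Rightarrow$ (1).
   Context: All rings are associative with $1\neq 0$ and all modules are unitary. A Morita context is a 4-tuple $(R,V,W,S)$, where $R,S$ are rings, ${}_RV_S$ and ${}_SW_R$ are bimodules, with context products $V\times W\to R$, $(v,w)\mapsto vw$, and $W\times V\to S$, $(w,v)\mapsto wv$, such that $\begin{pmatrix} R & V\\ W & S\end{pmatrix}$ is an associative ring under the usual matrix operations; this ring is also denoted $(R,V,W,S)$. $VW$ and $WV$ denote the sets of finite sums of context products. A ring $A$ is prime if for all $a,b\in A$, $aAb=0$ implies $a=0$ or $b=0$. A left $A$-module $M$ is prime if $0$ is a prime submodule of $M$, i.e., for all $r\in A$ and $m\in M$, $rAm=0$ implies $rM=0$ or $m=0$; a right $A$-module $M$ is prime if, symmetrically, $mAr=0$ implies $Mr=0$ or $m=0$. A bimodule is called a prime module if it is prime both as a left module and as a right module. *)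

(* Defs.v *)
From HB Require Import structures.
From mathcomp Require Import all_boot all_order all_algebra.

Set Implicit Arguments.
Unset Strict Implicit.
Unset Printing Implicit Defensive.

Import GRing.Theory.
Local Open Scope ring_scope.

(* MathComp provides left modules (lmodType) but neither right modules nor
   bimodules over two distinct rings.                                         *)

HB.mixin Record Zmodule_isRmodule (S : nzRingType) V of GRing.Zmodule V := {
  ract : V -> S -> V;
  ractA : forall v s t, ract (ract v s) t = ract v (s * t);
  ract1 : forall v, ract v 1 = v;
  ractDl : forall u v s, ract (u + v) s = ract u s + ract v s;
  ractDr : forall v s t, ract v (s + t) = ract v s + ract v t
}.
#[short(type="rmodType")]
HB.structure Definition Rmodule (S : nzRingType) :=
  {V of GRing.Zmodule V & Zmodule_isRmodule S V}.

Notation "v :* s" := (ract v s) (at level 40) : ring_scope.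

HB.mixin Record Lmodule_Rmodule_isBimodule (R S : nzRingType) V
    of GRing.Lmodule R V & Rmodule S V := {
  scale_ractA : forall (r : R) (v : V) (s : S), (r *: v) :* s = r *: (v :* s)
}.
#[short(type="bimodType")]
HB.structure Definition Bimodule (R S : nzRingType) :=
  {V of GRing.Lmodule R V & Rmodule S V & Lmodule_Rmodule_isBimodule R S V}.

Section MoritaMatrix.

Variables (R S : nzRingType) (V : bimodType R S) (W : bimodType S R).

(* ((r, v), (w, s)) stands for the matrix with rows (r v) and (w s). *)
Definition morita_mx : Type := ((R * V) * (W * S))%type.

HB.instance Definition _ := GRing.Zmodule.on morita_mx.

Definition morita_mx_one : morita_mx := ((1, 0), (0, 1)).

Definition morita_mx_mul (mvw : V -> W -> R) (mwv : W -> V -> S)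
    (a b : morita_mx) : morita_mx :=
  let: ((r, v), (w, s)) := a in
  let: ((r', v'), (w', s')) := b in
  ((r * r' + mvw v w', r *: v' + v :* s'),
   (w :* r' + s *: w', mwv w v' + s * s')).

(* The matrices form an associative ring under these operations; the unit laws
   are not listed because they follow from distributivity.                    *)
Record morita_context := MoritaContext {
  mvw : V -> W -> R;
  mwv : W -> V -> S;
  morita_mx_mulA : associative (morita_mx_mul mvw mwv);
  morita_mx_mulDl : left_distributive (morita_mx_mul mvw mwv) +%R;
  morita_mx_mulDr : right_distributive (morita_mx_mul mvw mwv) +%R
}.

Definition morita_ring of morita_context : Type := morita_mx.

Variable C : morita_context.

HB.instance Definition _ := GRing.Zmodule.on (morita_ring C).

Let mul : morita_mx -> morita_mx -> morita_mx := morita_mx_mul (mvw C) (mwv C).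

Fact morita_mul0mx (a : morita_mx) : mul 0 a = 0.
Proof. by apply: (addIr (mul 0 a)); rewrite -morita_mx_mulDl !add0r. Qed.

Fact morita_mulmx0 (a : morita_mx) : mul a 0 = 0.
Proof. by apply: (addIr (mul a 0)); rewrite -morita_mx_mulDr !add0r. Qed.

Fact rmod_ractr0 (T : nzRingType) (M : rmodType T) (v : M) : v :* (0 : T) = 0.
Proof. by apply: (addIr (v :* (0 : T))); rewrite -ractDr !add0r. Qed.

Fact rmod_ract0r (T : nzRingType) (M : rmodType T) (s : T) : (0 : M) :* s = 0.
Proof. by apply: (addIr ((0 : M) :* s)); rewrite -ractDl !add0r. Qed.

Fact mvw0l w : mvw C 0 w = 0.
Proof.
have := morita_mul0mx ((0, 0), (w, 0)).
by case=> + _ _ _; rewrite mulr0 add0r.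
Qed.

Fact mwv0l v : mwv C 0 v = 0.
Proof.
have := morita_mul0mx ((0, v), (0, 0)).
by case=> _ _ _; rewrite mulr0 addr0.
Qed.

Fact mvw0r v : mvw C v 0 = 0.
Proof.
have := morita_mulmx0 ((0, v), (0, 0)).
by case=> + _ _ _; rewrite mulr0 add0r.
Qed.

Fact mwv0r w : mwv C w 0 = 0.
Proof.
have := morita_mulmx0 ((0, 0), (w, 0)).
by case=> _ _ _; rewrite mulr0 addr0.
Qed.

Fact morita_mul1mx : left_id morita_mx_one mul.
Proof.
move=> [[r v] [w s]]; rewrite /mul /=.
by rewrite mvw0l mwv0l !mul1r !scale1r !rmod_ract0r !addr0 !add0r.
Qed.

Fact morita_mulmx1 : right_id morita_mx_one mul.
Proof.
move=> [[r v] [w s]]; rewrite /mul /=.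
by rewrite mvw0r mwv0r !mulr1 !ract1 !scaler0 !addr0 !add0r.
Qed.

Fact morita_mx_one_neq0 : morita_mx_one != 0.
Proof. by apply/eqP; case=> /eqP; rewrite oner_eq0. Qed.

HB.instance Definition _ := GRing.Zmodule_isNzRing.Build (morita_ring C)
  (@morita_mx_mulA C) morita_mul1mx morita_mulmx1
  (@morita_mx_mulDl C) (@morita_mx_mulDr C) morita_mx_one_neq0.

Definition VW_set (r : R) : Prop :=
  exists s : seq (V * W), r = \sum_(p <- s) mvw C p.1 p.2.

Definition WV_set (t : S) : Prop :=
  exists s : seq (W * V), t = \sum_(p <- s) mwv C p.1 p.2.

End MoritaMatrix.

Definition prime_ring (A : nzRingType) : Prop :=
  forall a b : A, (forall x : A, a * x * b = 0) -> a = 0 \/ b = 0.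

Definition prime_lmod (A : nzRingType) (M : lmodType A) : Prop :=
  forall (r : A) (m : M), (forall x : A, (r * x) *: m = 0) ->
    (forall n : M, r *: n = 0) \/ m = 0.

Definition prime_rmod (A : nzRingType) (M : rmodType A) : Prop :=
  forall (r : A) (m : M), (forall x : A, m :* (x * r) = 0) ->
    (forall n : M, n :* r = 0) \/ m = 0.

Definition prime_bimod (R S : nzRingType) (M : bimodType R S) : Prop :=
  @prime_lmod R M /\ @prime_rmod S M.

(* Main.v *)
(* Write T for the matrix ring.  If T is prime, placing single entries r, v, w, s
   in a matrix turns each of the conditions in (2) into the primeness of T.
   Conversely let e be one of the two diagonal idempotents.  If VW = R and
   WV = S then T e T = T, so every nonzero a in T has a nonzero e p a q e; when
   the corner e T e is prime, a T b = 0 thus forces a = 0 or b = 0. *)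
Require Import Defs.
From mathcomp Require Import all_boot all_order all_algebra.

Set Implicit Arguments.
Unset Strict Implicit.
Unset Printing Implicit Defensive.

Import GRing.Theory.
Local Open Scope ring_scope.

(** * Primeness inherited from a full corner *)

Section FullElement.

Variables (A : nzRingType) (e : A) (s : seq (A * A)).
Hypothesis full_e : 1 = \sum_(p <- s) p.1 * e * p.2.

(** Expanding both units in [1 * a * 1] writes [a] through elements of the corner $eAe$. *)
Lemma full_decomposition (a : A) :
  a = \sum_(p <- s) \sum_(q <- s) p.1 * (e * (p.2 * a * q.1) * e) * q.2.
Proof.
rewrite -[LHS]mul1r -[LHS]mulr1 full_e mulr_suml mulr_suml.
by apply: eq_bigr => p _; rewrite mulr_sumr;
   apply: eq_bigr => q _; rewrite !mulrA.
Qed.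

(* Only the finitely many corners met by the decomposition have to be tested,
   which keeps the case distinction decidable. *)
Lemma full_corner_eq0 (a : A) :
  a = 0 \/ exists p q : A, e * (p * a * q) * e != 0.
Proof.
case: (boolP (all (fun p => all (fun q => e * (p.2 * a * q.1) * e == 0) s) s)).
  move=> /allP a0; left; rewrite [LHS]full_decomposition.
  rewrite big_seq big1 // => p /a0 /allP ap0.
  by rewrite big_seq big1 // => q /ap0 /eqP ->; rewrite mulr0 mul0r.
by move=> /allPn[p _ /allPn[q _ nz]]; right; exists p.2, q.1.
Qed.

(** The hypothesis is primeness of $eAe$, phrased inside [A] so that the corner need not be built as
    a ring: for idempotent [e], the middle factor [x] may be replaced by [e * x * e]. *)
Lemma full_corner_prime :
  (forall a b : A, (forall x, (e * a * e) * x * (e * b * e) = 0) ->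
     e * a * e = 0 \/ e * b * e = 0) ->
  prime_ring A.
Proof.
move=> prime_e a b ab0.
have [|[p [q /eqP a_nz]]] := full_corner_eq0 a; first by left.
have [|[p' [q' /eqP b_nz]]] := full_corner_eq0 b; first by right.
have [x||] := prime_e (p * a * q) (p' * b * q'); [|by []|by []].
(* Regrouping exposes a factor $a y b$ with $y = q e x e p'$, which vanishes. *)
transitivity (e * p * (a * (q * e * x * e * p') * b) * (q' * e)).
  by rewrite !mulrA.
by rewrite ab0 mulr0 mul0r.
Qed.

End FullElement.

Section MoritaContext.

Variables (R S : nzRingType) (V : bimodType R S) (W : bimodType S R).
Variable C : morita_context V W.

Local Notation T := (morita_ring C).

(** The four Peirce components; [mx_ul 1] and [mx_dr 1] are the diagonal idempotents. *)
Definition mx_ul (r : R) : T := ((r, 0), (0, 0)).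
Definition mx_ur (v : V) : T := ((0, v), (0, 0)).
Definition mx_dl (w : W) : T := ((0, 0), (w, 0)).
Definition mx_dr (s : S) : T := ((0, 0), (0, s)).

Lemma morita_mulE (r r' : R) (v v' : V) (w w' : W) (s s' : S) :
  (((r, v), (w, s)) : T) * (((r', v'), (w', s')) : T) =
  ((r * r' + mvw C v w', r *: v' + v :* s'),
   (w :* r' + s *: w', mwv C w v' + s * s')).
Proof. by []. Qed.

Lemma morita_addE (r r' : R) (v v' : V) (w w' : W) (s s' : S) :
  (((r, v), (w, s)) : T) + (((r', v'), (w', s')) : T) =
  ((r + r', v + v'), (w + w', s + s')).
Proof. by []. Qed.

Definition morita_simp :=
  (morita_mulE, mvw0l, mvw0r, mwv0l, mwv0r, rmod_ract0r, rmod_ractr0,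
   scale0r, scaler0, mul0r, mulr0, addr0, add0r).

Lemma mx_ul_corner (r : R) (v : V) (w : W) (s : S) :
  mx_ul 1 * (((r, v), (w, s)) : T) * mx_ul 1 = mx_ul r.
Proof. by rewrite /mx_ul !morita_simp mul1r mulr1. Qed.

Lemma mx_dr_corner (r : R) (v : V) (w : W) (s : S) :
  mx_dr 1 * (((r, v), (w, s)) : T) * mx_dr 1 = mx_dr s.
Proof. by rewrite /mx_dr !morita_simp mul1r mulr1. Qed.

Lemma mx_ul_sum (I : Type) (l : seq I) (F : I -> R) :
  mx_ul (\sum_(i <- l) F i) = \sum_(i <- l) mx_ul (F i).
Proof.
by apply: big_morph => // r r'; rewrite /mx_ul morita_addE !addr0.
Qed.

Lemma mx_dr_sum (I : Type) (l : seq I) (F : I -> S) :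
  mx_dr (\sum_(i <- l) F i) = \sum_(i <- l) mx_dr (F i).
Proof.
by apply: big_morph => // s s'; rewrite /mx_dr morita_addE !addr0.
Qed.

Lemma mx_diag1 : mx_ul 1 + mx_dr 1 = 1.
Proof. by rewrite morita_addE !addr0 !add0r. Qed.

Lemma mx_ul_full : WV_set C 1 ->
  exists l : seq (T * T), 1 = \sum_(p <- l) p.1 * mx_ul 1 * p.2.
Proof.
move=> [l def1].
(* The pair [(1, 1)] contributes [mx_ul 1]; the others contribute the terms $wv$ in the lower right
   corner, which add up to [mx_dr 1]. *)
exists ((1, 1) :: [seq (mx_dl p.1, mx_ur p.2) | p <- l]).
rewrite big_cons big_map /= mul1r mulr1 -[LHS]mx_diag1 def1 mx_dr_sum.
congr (_ + _); apply: eq_bigr => p _.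
by rewrite /mx_dl /mx_ul /mx_ur !morita_simp ract1.
Qed.

Lemma mx_dr_full : VW_set C 1 ->
  exists l : seq (T * T), 1 = \sum_(p <- l) p.1 * mx_dr 1 * p.2.
Proof.
move=> [l def1].
exists ((1, 1) :: [seq (mx_ur p.1, mx_dl p.2) | p <- l]).
rewrite big_cons big_map /= mul1r mulr1 -[LHS]mx_diag1 addrC def1 mx_ul_sum.
congr (_ + _); apply: eq_bigr => p _.
by rewrite /mx_dl /mx_dr /mx_ur !morita_simp ract1.
Qed.

(** The corner cut out by [mx_ul 1] is a copy of [R], and $1 \in WV$ makes it full. *)
Lemma prime_ul_morita : WV_set C 1 -> prime_ring R -> prime_ring T.
Proof.
move=> /mx_ul_full[l full] primeR; apply: (full_corner_prime full).
move=> [[r v] [w s]] [[r' v'] [w' s']]; rewrite !mx_ul_corner => rr'0.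
have [x|->|->] := primeR r r'; [|by left|by right].
by have := rr'0 (mx_ul x); rewrite /mx_ul !morita_simp; case.
Qed.

Lemma prime_dr_morita : VW_set C 1 -> prime_ring S -> prime_ring T.
Proof.
move=> /mx_dr_full[l full] primeS; apply: (full_corner_prime full).
move=> [[r v] [w s]] [[r' v'] [w' s']]; rewrite !mx_dr_corner => ss'0.
have [x|->|->] := primeS s s'; [|by left|by right].
by have := ss'0 (mx_dr x); rewrite /mx_dr !morita_simp; case.
Qed.

(** * Primeness passing from the matrix ring to its entries *)

Section PrimeMorita.

Hypothesis primeT : prime_ring T.

Lemma prime_morita_ul : prime_ring R.
Proof.
move=> r r' rr'0.
have [[[x y] [z t]]|[->]|[->]] := primeT (a := mx_ul r) (b := mx_ul r').
- by rewrite /mx_ul !morita_simp rr'0.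
- by left.
- by right.
Qed.

Lemma prime_morita_dr : prime_ring S.
Proof.
move=> s s' ss'0.
have [[[x y] [z t]]|[->]|[->]] := primeT (a := mx_dr s) (b := mx_dr s').
- by rewrite /mx_dr !morita_simp ss'0.
- by left.
- by right.
Qed.

(** The products [mx_ul r * t * mx_ur v] and [mx_ur v * t * mx_dr s] have a single entry, governed
    by one diagonal entry of [t]. Primeness then yields $r = 0$ or $s = 0$ outright, hence $rV = 0$
    or $Vs = 0$, unless $v = 0$. *)
Lemma prime_morita_ur : prime_bimod V.
Proof.
split=> [r v rv0|s v vs0].
  have [[[x y] [z t]]|[->]|[->]] := primeT (a := mx_ul r) (b := mx_ur v).
  - by rewrite /mx_ul /mx_ur !morita_simp rv0.
  - by left=> n; rewrite scale0r.
  - by right.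
have [[[x y] [z t]]|[->]|[->]] := primeT (a := mx_ur v) (b := mx_dr s).
- by rewrite /mx_dr /mx_ur !morita_simp ractA vs0.
- by right.
- by left=> n; rewrite rmod_ractr0.
Qed.

Lemma prime_morita_dl : prime_bimod W.
Proof.
split=> [s w sw0|r w wr0].
  have [[[x y] [z t]]|[->]|[->]] := primeT (a := mx_dr s) (b := mx_dl w).
  - by rewrite /mx_dr /mx_dl !morita_simp sw0.
  - by left=> n; rewrite scale0r.
  - by right.
have [[[x y] [z t]]|[->]|[->]] := primeT (a := mx_dl w) (b := mx_ul r).
- by rewrite /mx_ul /mx_dl !morita_simp ractA wr0.
- by right.
- by left=> n; rewrite rmod_ractr0.
Qed.

End PrimeMorita.

End MoritaContext.

Theorem theorem2p13 (R S : nzRingType) (V : bimodType R S) (W : bimodType S R)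
    (C : morita_context V W) :
  let cond1 := prime_ring (morita_ring C) in
  let cond2 := (prime_ring R /\ prime_ring S) /\
               (prime_bimod V /\ prime_bimod W) in
  let cond3 := prime_ring R /\ prime_ring S in
  let cond4 := prime_ring R \/ prime_ring S in
  (cond1 -> cond2) /\ (cond2 -> cond3) /\ (cond3 -> cond4) /\
  ((forall r : R, VW_set C r) -> (forall s : S, WV_set C s) ->
   cond4 -> cond1).
Proof.
move=> cond1 cond2 cond3 cond4; split=> [primeT|]; last first.
  split; first by case.
  split; first by case; left.
  (* The roles cross: a prime [R] needs $1 \in WV$, a prime [S] needs $1 \in VW$. *)
  by move=> VW WV [/(prime_ul_morita (WV 1))|/(prime_dr_morita (VW 1))].
split; split.
- exact: prime_morita_ul primeT.
- exact: prime_morita_dr primeT.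
- exact: prime_morita_ur primeT.
- exact: prime_morita_dl primeT.
Qed.
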